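(* Let $C\in\mathbb D$ of dimension $n$, $N=rn$, and let $W$ be the differential operator $W(u)=|Wr(\phi_1,\dots,\phi_N,u)|$. Then (1) $W$ is a differential operator of order $N$ with polynomial coefficients (so it lies in the Weyl algebra); (2) the coefficient of $\partial^N$ in $W$ is a polynomial in $x$ of degree exactly $n$, so $W$ has a unique nonzero scalar multiple $\bar K_C$ whose coefficient of $\partial^N$ is a monic polynomial of degree $n$; (3) $\bar K_C^\flat$ also has order $N$ in $\partial$.
   Context: Fix an integer $r>1$ and constants $a_1,\dots,a_{r-2}\in\mathbb C$, and let $L_0=\partial^r-a_{r-2}\partial^{r-2}-\cdots-a_1\partial-x$, where $\partial=d/dx$. Fix a basis $f_1,\dots,f_r$ of $\ker L_0$ normalized so that $|Wr(f_1,\dots,f_r)|=1$. For a function $f$ of one variable write $\hat f(x,z)=f(x+z)$. $\mathcal S$ denotes the space of finitely supported distributions in the $z$-plane: finite linear combinations of $\delta_\lambda\circ\partial_z^j$, where $\delta_\lambda$ evaluates its argument at $z=\lambda$; applied to a function of $(x,z)$ such a distribution acts in $z$ and yields a function of $x$. $\mathbb D$ is the set of finite-dimensional subspaces $C\subset\mathcal S$ having a basis $c_i=\delta_{\lambda_i}\circ(\partial_z+\gamma_i)$, $i=1,\dots,n$ ($n\ge1$), with $\lambda_1,\dots,\lambda_n$ pairwise distinct and $\gamma_i\in\mathbb C$; for such $C$, $\phi_1,\dots,\phi_N$ ($N=rn$) are the functions $c_i(\hat f_j)$, $1\le i\le n$, $1\le j\le r$. $Wr(v_1,\dots,v_m)$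 is the $m\times m$ matrix whose first row is $(v_1,\dots,v_m)$ and each subsequent row is the derivative of the previous one; $|\cdot|$ is the determinant. The Weyl algebra is $\mathbb C[x]\langle\partial\rangle$; $\flat$ is the unique $\mathbb C$-linear anti-automorphism of the Weyl algebra with $x^\flat=L_0$, $\partial^\flat=\partial$ (equivalently $T(x,\partial_x)\hat f(x,z)=T^\flat(z,\partial_z)\hat f(x,z)$ for all $f\in\ker L_0$). *)

(* Defs.v *)
(* Complex numbers are R[i] for R : realType
   (mathcomp-real-closed's `complex`), viewed as a numFieldType so that
   MathComp-Analysis' derivatives (derive1n, derivable) are complex derivatives. *)
From HB Require Import structures.
From mathcomp Require Import all_boot all_order all_algebra.
From mathcomp Require Import complex.
From mathcomp Require Import all_classical all_reals all_analysis.
Import numFieldNormedType.Exports.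
Import GRing.Theory Num.Theory.

Set Implicit Arguments.
Unset Strict Implicit.
Unset Printing Implicit Defensive.

Local Open Scope ring_scope.

Definition Cx (R : realType) : numFieldType := R[i].

Section Defs.
Variable R : realType.
Local Notation C := (Cx R).

Definition wronskian (m : nat) (v : nat -> C -> C) (x : C) : 'M[C]_m :=
  \matrix_(i < m, j < m) derive1n i (v j) x.

(* phi_k = c_i(\hat f_j) with c_i = delta_{lam_i} o (d_z + gam_i),
   where k = i * r + j, 0 <= i < n, 0 <= j < r; i.e.
   phi_k(x) = f_j'(x + lam_i) + gam_i f_j(x + lam_i). *)
Definition phi (r : nat) (f : nat -> C -> C) (lam gam : nat -> C)
    (k : nat) (x : C) : C :=
  derive1n 1 (f (k %% r)%N) (x + lam (k %/ r)%N)
  + gam (k %/ r)%N * f (k %% r)%N (x + lam (k %/ r)%N).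

Definition Wdet (r n : nat) (f : nat -> C -> C) (lam gam : nat -> C)
    (u : C -> C) (x : C) : C :=
  \det (wronskian (n * r).+1
          (fun k => if (k < n * r)%N then phi r f lam gam k else u) x).

(* An element  sum_k p_k(x) d^k  (coefficients written to the LEFT of d)
   is represented by the polynomial  sum_k p_k 'X^k  in {poly {poly C}}:
   the outer variable 'X stands for d, the inner one for x. *)
Definition weyl := {poly {poly C}}.

Definition actW (P : weyl) (u : C -> C) (x : C) : C :=
  \sum_(k < size P) (P`_k).[x] * derive1n k u x.

Definition ordW (P : weyl) : nat := (size P).-1.

(* Product in the Weyl algebra, via Leibniz' rule:
   (p d^i)(q d^j) = sum_l binom(i,l) p q^(l) d^(i+j-l). *)
Definition mulW (P Q : weyl) : weyl :=
  \sum_(i < size P) \sum_(j < size Q) \sum_(l < i.+1)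
     ((P`_i * derivn l Q`_j) *+ 'C(i, l))%:P * 'X^(i + j - l).

Definition powW (T : weyl) (k : nat) : weyl := iter k (mulW T) 1.

Definition hornerW (p : {poly C}) (T : weyl) : weyl :=
  \sum_(i < size p) (p`_i)%:P%:P * powW T i.

Definition L0W (r : nat) (a : nat -> C) : weyl :=
  'X^r - \sum_(1 <= k < r.-1) (a k)%:P%:P * 'X^k - ('X)%:P.

(* The anti-automorphism flat (x |-> L_0, d |-> d):
   (sum_k p_k(x) d^k)^flat = sum_k d^k p_k(L_0). *)
Definition flat (r : nat) (a : nat -> C) (P : weyl) : weyl :=
  \sum_(k < size P) mulW ('X^k) (hornerW P`_k (L0W r a)).

End Defs.

(* Main.v *)
(** Write [T] for [L_0] and [d] for [d/dx], so that [[T, d] = 1] and flat is the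
    anti-automorphism exchanging [x] and [T] and fixing [d].  The operators
    [d^s T^m], [s < r], have leading coefficient [1] and order [s + r m], so the
    rows [1, d, ..., d^N] of the Wronskian may be replaced by them without changing
    the determinant.  Since [T g = lam g] for [g = f_j(. + lam)] and
    [T phi = lam phi + g] for [phi = (d + gam) g], one has
      [d^s T^m phi = (lam^m (d + gam) + m lam^(m-1)) d^s g];
    hence the [N] kernel columns factor as an explicit polynomial matrix [Z] times the
    Wronskians of the [f_j(. + lam_i)], which are constants, and
    [W = const * sum_(m, s) kappa_(m,s)(x) d^s T^m] with [kappa_(m,s)] the minors of
    [Z].  Giving [x] weight [r], row [(m, s)] weight [s + 1] and column [(i, t)]
    weight [t] shows [r deg kappa_(m,s) <= N - s], while the top coefficient of
    [kappa_(n,0)], in degree [n], is the determinant of (Vandermonde) (x) (cyclic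
    shift), which is nonzero.  Finally flat sends [kappa(x) d^s T^m] to
    [x^m d^s kappa(T)], of order at most [s + r deg kappa <= N]; order [N] only
    occurs for [s = 0], and there [kappa_(n,0)] is the only one to contribute to the
    term [x^n d^N]. *)
Require Import Defs.
From HB Require Import structures.
From mathcomp Require Import all_boot all_order all_algebra.
From mathcomp Require Import perm zify ring complex.
From mathcomp Require Import all_classical all_reals all_analysis.
Import numFieldNormedType.Exports.
Import Order.TTheory GRing.Theory Num.Theory.
Local Open Scope ring_scope.

Set Implicit Arguments.
Unset Strict Implicit.
Unset Printing Implicit Defensive.

(** * Normal forms in the Weyl algebra *)

Section ZmodMorphism.
Variables (U V : zmodType) (g : U -> V).
Hypothesis gB : zmod_morphism g.

Lemma zmod_morph0 : g 0 = 0.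
Proof. by rewrite -[0 in LHS](subrr 0) gB subrr. Qed.

Lemma zmod_morphD u v : g (u + v) = g u + g v.
Proof. by rewrite -[v in LHS]opprK -[- v]sub0r !gB zmod_morph0 sub0r opprK. Qed.

Lemma zmod_morph_sum I (s : seq I) (c : pred I) (F : I -> U) :
  g (\sum_(i <- s | c i) F i) = \sum_(i <- s | c i) g (F i).
Proof. exact: (big_morph g zmod_morphD zmod_morph0). Qed.

Lemma zmod_morphMn u k : g (u *+ k) = g u *+ k.
Proof. by elim: k => [|k IH]; rewrite ?mulr0n ?zmod_morph0 // !mulrS zmod_morphD IH. Qed.

End ZmodMorphism.

Section NormalForms.
Variable K : fieldType.
Local Notation W := {poly {poly K}}.
Implicit Types (P Q : W) (p : {poly K}).

(* Normal form of the product [d Q]; [wmul P Q] below is that of [P Q]. *)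
Definition dmul Q : W := Q * 'X + map_poly deriv Q.

Lemma dmulB : zmod_morphism dmul.
Proof. by move=> P Q; rewrite /dmul mulrBl raddfB addrACA -opprD. Qed.

Lemma coef_dmul Q i : (dmul Q)`_i = (if i == 0%N then 0 else Q`_i.-1) + (Q`_i)^`().
Proof. by rewrite coefD coefMX coef_map. Qed.

Lemma dmulZ p Q : dmul (p *: Q) = p *: dmul Q + p^`() *: Q.
Proof.
apply/polyP=> i; rewrite coef_dmul [RHS]coefD !coefZ coef_dmul derivM mulrDr.
by case: ifP => _; rewrite ?mulr0; ring.
Qed.

Lemma iter_dmulB k : zmod_morphism (iter k dmul).
Proof. by elim: k => // k IH P Q; rewrite !iterS IH dmulB. Qed.

Lemma iter_dmulZC k (c : K) Q : iter k dmul (c%:P *: Q) = c%:P *: iter k dmul Q.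
Proof. by elim: k => //= k ->; rewrite dmulZ derivC scale0r addr0. Qed.

(** By Pascal's rule, iterating [dmul] gives the binomial form in which [mulW] is defined; this
    links the two products. *)
Lemma Leibniz_dmul i Q :
  iter i dmul Q = \sum_(l < i.+1) (map_poly (derivn l) Q * 'X^(i - l)) *+ 'C(i, l).
Proof.
elim: i => [|i IH].
  rewrite big_ord1 /= mulr1; apply/polyP=> j.
  by rewrite coef_map_id0.
rewrite iterS IH (zmod_morph_sum dmulB).
pose t l := map_poly (derivn l) Q.
have Dt l : (l <= i)%N -> dmul (t l * 'X^(i - l)) = t l * 'X^(i.+1 - l) + t l.+1 * 'X^(i - l).
  move=> li; rewrite /dmul -mulrA -exprSr subSn //; congr (_ + _).
  apply/polyP=> j; rewrite coef_map /= !coefMXn; case: ifP => _; rewrite ?deriv0 //.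
  by rewrite !coef_map_id0 ?derivn0 // linear0.
under eq_bigr => l _ do rewrite (zmod_morphMn dmulB) Dt -1?ltnS // mulrnDl.
rewrite big_split /= [in RHS]big_ord_recl [X in X + _ = _]big_ord_recl /= !bin0 -!addrA.
congr (_ + _).
under [in RHS]eq_bigr => l _ do rewrite /bump /= add1n binS mulrnDr subSS.
rewrite big_split /=; congr (_ + _).
by rewrite [in RHS]big_ord_recr /= bin_small // mulr0n addr0.
Qed.

Lemma size_dmul Q t : (size Q <= t)%N -> (size (dmul Q) <= t.+1)%N.
Proof.
move=> /leq_sizeP Qt; apply/leq_sizeP=> -[|j] // tj.
by rewrite coef_dmul /= !Qt ?deriv0 ?addr0 // ltnW.
Qed.

Lemma size_iter_dmul k Q t : (size Q <= t)%N -> (size (iter k dmul Q) <= k + t)%N.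
Proof. by move=> Qt; elim: k => //= k IH; rewrite addSn size_dmul. Qed.

Lemma coef_iter_dmul k Q t : (size Q <= t.+1)%N -> (iter k dmul Q)`_(k + t) = Q`_t.
Proof.
move=> Qt; elim: k => //= k IH; rewrite addSn coef_dmul /= IH.
have := size_iter_dmul k Qt; rewrite addnS => s.
by rewrite [X in _ + X^`()]nth_default // deriv0 addr0.
Qed.

Definition wmul P Q : W := \sum_(i < size P) P`_i *: iter i dmul Q.

Lemma wmulE n P Q : (size P <= n)%N -> wmul P Q = \sum_(i < n) P`_i *: iter i dmul Q.
Proof.
move=> Pn; rewrite /wmul (big_ord_widen _ (fun i => P`_i *: iter i dmul Q) Pn) big_mkcond.
by apply: eq_bigr => i _; case: ltnP => // /leq_sizeP ->; rewrite ?scale0r.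
Qed.

Lemma wmulBl P1 P2 Q : wmul (P1 - P2) Q = wmul P1 Q - wmul P2 Q.
Proof.
set n := maxn (size P1) (size P2).
rewrite !(@wmulE n) ?leq_maxl ?leq_maxr //; last first.
  by rewrite (leq_trans (size_polyD _ _)) // size_polyN.
by rewrite -sumrB; apply: eq_bigr => i _; rewrite coefB scalerBl.
Qed.

Lemma wmulBr P : zmod_morphism (wmul P).
Proof.
move=> Q1 Q2; rewrite -sumrB; apply: eq_bigr => i _.
by rewrite iter_dmulB scalerBr.
Qed.

Lemma wmulZC P (c : K) Q : wmul P (c%:P *: Q) = c%:P *: wmul P Q.
Proof.
rewrite scaler_sumr; apply: eq_bigr => i _.
by rewrite iter_dmulZC !scalerA mulrC.
Qed.

Lemma wmulXn k Q : wmul 'X^k Q = iter k dmul Q.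
Proof.
rewrite (@wmulE k.+1) ?size_polyXn // big_ord_recr /= coefXn eqxx scale1r big1 ?add0r //.
by move=> i _; rewrite coefXn ltn_eqF ?scale0r.
Qed.

Lemma wmulZl p P Q : wmul (p *: P) Q = p *: wmul P Q.
Proof.
rewrite (@wmulE (size P)) ?size_scale_leq // scaler_sumr.
by apply: eq_bigr => i _; rewrite coefZ scalerA.
Qed.

Lemma wmulC p Q : wmul p%:P Q = p *: Q.
Proof. by rewrite -alg_polyC wmulZl -(expr0 'X) wmulXn. Qed.

Lemma wmul_suml I (s : seq I) (c : pred I) (F : I -> W) Q :
  wmul (\sum_(i <- s | c i) F i) Q = \sum_(i <- s | c i) wmul (F i) Q.
Proof.
apply: (big_morph (fun P => wmul P Q)) => [P1 P2|]; last first.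
  by rewrite /wmul size_poly0 big_ord0.
rewrite -[P2]opprK wmulBl opprK; congr (_ + _).
by rewrite -[- P2]sub0r wmulBl /wmul size_poly0 big_ord0 sub0r opprK.
Qed.

End NormalForms.

(** * The operator [T = L_0]: left and right multiplication, action on jets, and flat *)

Section Airy.
Variables (K : fieldType) (r : nat) (a : nat -> K).
Local Notation W := {poly {poly K}}.
Implicit Types (P Q : W) (p : {poly K}).

(** The constant-coefficient part of [L_0], which commutes with [d]; thus [T] is [ell - 'X%:P]. *)
Definition ell : W := 'X^r - \sum_(1 <= k < r.-1) (a k)%:P%:P * 'X^k.

Definition Tmul Q : W := wmul (ell - 'X%:P) Q.

(* Normal form of the product [P T]: moving [x] to the left across [P] produces
   the formal derivative of [P] in [d]. *)
Definition mulT P : W := (ell - 'X%:P) * P - P^`().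

Lemma TmulB : zmod_morphism Tmul.
Proof. exact: wmulBr. Qed.

Lemma TmulE Q : Tmul Q = wmul ell Q - 'X *: Q.
Proof. by rewrite /Tmul wmulBl wmulC. Qed.

Lemma wmul_ell Q :
  wmul ell Q = iter r (@dmul K) Q - \sum_(1 <= k < r.-1) (a k)%:P *: iter k (@dmul K) Q.
Proof.
rewrite /ell wmulBl wmulXn wmul_suml; congr (_ - _).
by apply: eq_bigr => k _; rewrite mul_polyC wmulZl wmulXn.
Qed.

(** This is [[T, d] = 1]: [ell] commutes with [d], and the extra term comes from [d x = x d + 1]. *)
Lemma Tmul_dmul Q : Tmul (dmul Q) = dmul (Tmul Q) + Q.
Proof.
rewrite !TmulE !wmul_ell !dmulB dmulZ derivX scale1r.
rewrite -iterS iterSr.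
have -> u v : u - (v + Q) + Q = u - v by rewrite opprD addrA subrK.
congr (_ - _ - _).
rewrite (zmod_morph_sum (@dmulB K)); apply: eq_bigr => k _.
by rewrite dmulZ derivC scale0r addr0 -iterS iterSr.
Qed.

Lemma Tmul_iter_dmul k Q :
  Tmul (iter k (@dmul K) Q) = iter k (@dmul K) (Tmul Q) + iter k.-1 (@dmul K) Q *+ k.
Proof.
elim: k => [|k IH] /=; first by rewrite mulr0n addr0.
rewrite Tmul_dmul IH (zmod_morphD (@dmulB K)) (zmod_morphMn (@dmulB K)) -addrA; congr (_ + _).
by case: k {IH} => [|k] /=; rewrite ?mulr0n ?add0r // [RHS]mulrSr.
Qed.

Lemma TmulZC (c : K) Q : Tmul (c%:P *: Q) = c%:P *: Tmul Q.
Proof. exact: wmulZC. Qed.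

Hypothesis r_gt1 : (1 < r)%N.

Lemma size_Tmul Q t : (size Q <= t)%N -> (size (Tmul Q) <= r + t)%N.
Proof.
move=> Qt; rewrite TmulE wmul_ell.
have le k : (k < r)%N -> (size (iter k (@dmul K) Q) <= r + t)%N.
  by move=> kr; rewrite (leq_trans (size_iter_dmul k Qt)) // leq_add2r ltnW.
rewrite (leq_trans (size_polyD _ _)) // size_polyN geq_max; apply/andP; split.
  rewrite (leq_trans (size_polyD _ _)) // size_polyN geq_max size_iter_dmul //=.
  rewrite big_nat_cond; elim/big_ind: _ => [|P1 P2 s1 s2|k].
  - by rewrite size_poly0.
  - by rewrite (leq_trans (size_polyD _ _)) // geq_max s1.
  rewrite andbT => /andP[_ kr]; rewrite (leq_trans (size_scale_leq _ _)) // le //.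
  by rewrite (leq_trans kr) // leq_pred.
by rewrite (leq_trans (size_scale_leq _ _)) // (le 0%N) // ltnW.
Qed.

Lemma coef_Tmul Q t : (size Q <= t.+1)%N -> (Tmul Q)`_(r + t) = Q`_t.
Proof.
move=> Qt; rewrite TmulE wmul_ell !coefB coef_iter_dmul // coef_sum.
have z k : (k < r)%N -> (iter k (@dmul K) Q)`_(r + t) = 0.
  move=> kr; rewrite nth_default //; apply: (leq_trans (size_iter_dmul k Qt)).
  by rewrite addnS ltn_add2r.
rewrite coefZ (z 0%N) ?(ltnW r_gt1) // mulr0 subr0 big_nat_cond big1 ?subr0 //.
move=> k; rewrite andbT => /andP[_ kr]; rewrite coefZ z ?mulr0 //.
by rewrite (leq_trans kr) // leq_pred.
Qed.

Lemma mulTZ p P : mulT (p *: P) = p *: mulT P.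
Proof. by rewrite /mulT derivZ -scalerAr scalerBr. Qed.

(** Multiplying a normal form by ['X] is composing with [d] on the right, so this is [[T, d] = 1]
    seen from the right. *)
Lemma mulT_mulX P : mulT P * 'X = mulT (P * 'X) + P.
Proof. by rewrite /mulT derivM derivX mulr1 mulrBl mulrA opprD addrA subrK. Qed.

(** Normal form of [d^s T^m] for [k = m r + s], [s < r]. These operators are monic of order [k],
    hence unitriangular over the powers of [d]. *)
Definition airy_basis (k : nat) : W := iter (k %/ r) mulT 'X^(k %% r).

Lemma size_ell_subX : size (ell - 'X%:P) = r.+1.
Proof.
have small : (size (\sum_(1 <= k < r.-1) (a k)%:P%:P * 'X^k + 'X%:P : W)%R <= r)%N.
  rewrite (leq_trans (size_polyD _ _)) // geq_max; apply/andP; split; last first.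
    by rewrite (leq_trans (size_polyC_leq1 _)) // ltnW.
  rewrite big_nat_cond; elim/big_ind: _ => [|P1 P2 s1 s2|k].
  - by rewrite size_poly0.
  - by rewrite (leq_trans (size_polyD _ _)) // geq_max s1.
  rewrite andbT => /andP[_ kr].
  rewrite mul_polyC (leq_trans (size_scale_leq _ _)) // size_polyXn.
  by rewrite (leq_trans kr) // leq_pred.
by rewrite /ell -addrA -opprD size_polyDl ?size_polyXn // size_polyN ltnS.
Qed.

Lemma monic_ell_subX : ell - 'X%:P \is monic.
Proof.
rewrite monicE lead_coefE size_ell_subX /= /ell !coefB coefXn eqxx coefC.
rewrite (gtn_eqF (ltnW r_gt1)) subr0 coef_sum big_nat_cond big1 ?subr0 //.
move=> k; rewrite andbT => /andP[_ kr]; rewrite coefCM coefXn gtn_eqF ?mulr0 //.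
by rewrite (leq_trans kr) // leq_pred.
Qed.

Lemma mulT_monic P : P \is monic -> mulT P \is monic /\ size (mulT P) = (r + size P)%N.
Proof.
move=> Pm; have P0 := monic_neq0 Pm.
have s : size ((ell - 'X%:P) * P) = (r + size P)%N.
  by rewrite size_proper_mul ?size_ell_subX ?(monicP monic_ell_subX) ?mul1r ?lead_coef_eq0.
have lt : (size (- P^`())%R < size ((ell - 'X%:P) * P)%R)%N.
  by rewrite s size_polyN (leq_trans (lt_size_deriv P0)) // leq_addl.
rewrite /mulT size_polyDl // monicE lead_coefDl // lead_coef_Mmonic //.
by rewrite -monicE monic_ell_subX.
Qed.

Lemma airy_basis_monic k : airy_basis k \is monic /\ size (airy_basis k) = k.+1.
Proof.
rewrite [in k.+1](divn_eq k r) /airy_basis; elim: (k %/ r)%N => [|m [mon sz]] /=.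
  by rewrite monicXn size_polyXn.
by have [-> ->] := mulT_monic mon; rewrite sz mulSn addnS addnA.
Qed.

(* Evaluation at [x] of the operator with normal form [P] on a function whose
   sequence of derivatives at [x] is [F]. *)
Definition ev (F : nat -> K) x P := \sum_(k < size P) (P`_k).[x] * F k.

Lemma evE n F x P : (size P <= n)%N -> ev F x P = \sum_(k < n) (P`_k).[x] * F k.
Proof.
move=> Pn; rewrite /ev (big_ord_widen _ (fun k => (P`_k).[x] * F k) Pn) big_mkcond.
by apply: eq_bigr => i _; case: ltnP => // /leq_sizeP ->; rewrite ?horner0 ?mul0r.
Qed.

Lemma evB F x : zmod_morphism (ev F x).
Proof.
move=> P1 P2; set n := maxn (size P1) (size P2).
rewrite !(@evE n) ?leq_maxl ?leq_maxr //; last first.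
  by rewrite (leq_trans (size_polyD _ _)) // size_polyN.
by rewrite -sumrB; apply: eq_bigr => i _; rewrite coefB hornerD hornerN mulrBl.
Qed.

Lemma ev_sum I (s : seq I) (c : pred I) (G : I -> W) F x :
  ev F x (\sum_(i <- s | c i) G i) = \sum_(i <- s | c i) ev F x (G i).
Proof. exact: (zmod_morph_sum (evB F x)). Qed.

Lemma evZ p P F x : ev F x (p *: P) = p.[x] * ev F x P.
Proof.
rewrite (@evE (size P)) ?size_scale_leq // mulr_sumr.
by apply: eq_bigr => k _; rewrite coefZ hornerM mulrA.
Qed.

Lemma ev_mulX P F x : ev F x (P * 'X) = ev (fun k => F k.+1) x P.
Proof.
rewrite (@evE (size P).+1); last first.
  by rewrite (leq_trans (size_polyMleq _ _)) // size_polyX addn2.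
rewrite big_ord_recl coefMX horner0 mul0r add0r.
by apply: eq_bigr => k _; rewrite coefMX.
Qed.

Lemma ev_mulXn j P F x : ev F x (P * 'X^j) = ev (fun k => F (j + k)%N) x P.
Proof.
elim: j F => [|j IH] F; first by rewrite mulr1.
by rewrite exprSr mulrA ev_mulX IH; apply: eq_bigr => k _; rewrite addSn.
Qed.

Lemma ev_deriv P F x : ev F x P^`() = ev (fun k => F k.-1 *+ k) x P.
Proof.
rewrite (@evE (size P)); last first.
  by rewrite (leq_trans (size_poly _ _)) // leq_pred.
have Pn := leqnn (size P); rewrite [RHS](evE _ _ Pn).
case: {-1}(size P) Pn => [|n] Pn; first by rewrite !big_ord0.
rewrite big_ord_recr big_ord_recl /= mulr0n mulr0 add0r.
have /leq_sizeP/(_ n (leqnn n)) -> : (size P^`() <= n)%N.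
  by rewrite (leq_trans (size_poly _ _)) // -subn1 leq_subLR.
rewrite horner0 mul0r addr0.
by apply: eq_bigr => k _; rewrite coef_deriv /bump add1n hornerMn mulrnAl mulrnAr.
Qed.

Lemma ev_mulT P F x :
  ev F x (mulT P) = ev (fun k => F (r + k)%N
     - \sum_(1 <= j < r.-1) a j * F (j + k)%N - x * F k - F k.-1 *+ k) x P.
Proof.
rewrite /mulT /ell !(mulrBl, evB) ev_deriv mul_polyC evZ hornerX.
rewrite mulrC ev_mulXn mulr_suml ev_sum.
under eq_bigr => j _ do rewrite -mulrA mul_polyC evZ hornerC [_ * P]mulrC ev_mulXn.
rewrite /ev mulr_sumr.
under eq_bigr => j _ do rewrite mulr_sumr.
rewrite exchange_big -!sumrB /=; apply: eq_bigr => k _.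
rewrite !mulrBr mulr_sumr; congr (_ - _ - _ - _); last by rewrite mulrCA.
by apply: eq_bigr => j _; rewrite mulrCA.
Qed.

(* The relation [d^k (T - lam) g = 0] at [x]; for [k = 0] the junk term [F k.-1]
   has coefficient [0]. *)
Definition airy_jet (lam x : K) (F : nat -> K) := forall k,
  F (r + k)%N = \sum_(1 <= j < r.-1) a j * F (j + k)%N + (x + lam) * F k + F k.-1 *+ k.

(** [mulT P] applies [T] before [P], and [T] acts as [lam] on the function with jet [F]. *)
Lemma ev_mulT_jet P lam x F : airy_jet lam x F -> ev F x (mulT P) = lam * ev F x P.
Proof.
move=> jF; rewrite ev_mulT mulr_sumr; apply: eq_bigr => k _.
rewrite jF mulrCA; congr (_ * _).
by ring.
Qed.


(* Normal forms of [p(T)], and of the image under flat of the operator [P]. *)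
Definition hornerT p : W := \sum_(i < size p) (p`_i)%:P *: iter i Tmul 1.

Lemma hornerTE n p : (size p <= n)%N -> hornerT p = \sum_(i < n) (p`_i)%:P *: iter i Tmul 1.
Proof.
move=> pn; rewrite /hornerT (big_ord_widen _ (fun i => (p`_i)%:P *: iter i Tmul 1) pn) big_mkcond.
by apply: eq_bigr => i _; case: ltnP => // /leq_sizeP ->; rewrite ?scale0r.
Qed.

Lemma hornerTB : zmod_morphism hornerT.
Proof.
move=> p q; set n := maxn (size p) (size q).
rewrite !(@hornerTE n) ?leq_maxl ?leq_maxr //; last first.
  by rewrite (leq_trans (size_polyD _ _)) // size_polyN.
by rewrite -sumrB; apply: eq_bigr => i _; rewrite coefB polyCB scalerBl.
Qed.

Lemma hornerTZ (c : K) p : hornerT (c *: p) = c%:P *: hornerT p.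
Proof.
rewrite (@hornerTE (size p)) ?size_scale_leq // scaler_sumr.
by apply: eq_bigr => i _; rewrite coefZ polyCM scalerA.
Qed.

Lemma hornerTX p : hornerT ('X * p) = Tmul (hornerT p).
Proof.
rewrite (@hornerTE (size p).+1); last first.
  by rewrite (leq_trans (size_polyMleq _ _)) // size_polyX.
rewrite big_ord_recl coefXM scale0r add0r (zmod_morph_sum TmulB).
by apply: eq_bigr => i _; rewrite coefXM /= TmulZC.
Qed.

Lemma size_iter_Tmul i t Q : (size Q <= t)%N -> (size (iter i Tmul Q) <= r * i + t)%N.
Proof. by move=> Qt; elim: i => [|i IH]; rewrite ?muln0 // iterS mulnS -addnA size_Tmul. Qed.

Lemma coef_iter_Tmul i t Q : (size Q <= t.+1)%N -> (iter i Tmul Q)`_(r * i + t) = Q`_t.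
Proof.
move=> Qt; elim: i => [|i IH]; rewrite ?muln0 // iterS mulnS -addnA coef_Tmul //.
by rewrite -addnS size_iter_Tmul.
Qed.

Lemma size_hornerT d p : (size p <= d.+1)%N -> (size (hornerT p) <= (r * d).+1)%N.
Proof.
move=> pd; rewrite (hornerTE pd); elim/big_ind: _ => [|P1 P2 s1 s2|i _].
- by rewrite size_poly0.
- by rewrite (leq_trans (size_polyD _ _)) // geq_max s1.
apply: leq_trans (size_scale_leq _ _) _.
apply: leq_trans (@size_iter_Tmul i 1 1 _) _; rewrite ?size_poly1 // addn1 ltnS leq_mul2l.
by rewrite -ltnS ltn_ord orbT.
Qed.

(** Only [T^d] reaches order [r d], and it has leading coefficient 1. *)
Lemma coef_hornerT d p : (size p <= d.+1)%N -> (hornerT p)`_(r * d) = (p`_d)%:P.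
Proof.
move=> pd; rewrite (hornerTE pd) big_ord_recr coefD coef_sum big1 => [|i _].
  rewrite add0r coefZ -[(r * d)%N]addn0 coef_iter_Tmul ?size_poly1 //.
  by rewrite coef1 eqxx mulr1.
rewrite coefZ (_ : (iter i Tmul 1)`_(r * d)%N = 0) ?mulr0 //; apply: nth_default.
apply: leq_trans (@size_iter_Tmul i 1 1 _) _; rewrite ?size_poly1 //.
by rewrite addn1 ltn_mul2l (ltnW r_gt1) ltn_ord.
Qed.

Definition flatW P : W := \sum_(k < size P) iter k (@dmul K) (hornerT P`_k).

Lemma flatWE n P : (size P <= n)%N -> flatW P = \sum_(k < n) iter k (@dmul K) (hornerT P`_k).
Proof.
move=> Pn; rewrite /flatW (big_ord_widen _ (fun k => iter k (@dmul K) (hornerT P`_k)) Pn) big_mkcond.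
apply: eq_bigr => i _; case: ltnP => // /leq_sizeP -> //.
by rewrite (zmod_morph0 hornerTB) (zmod_morph0 (@iter_dmulB K i)).
Qed.

Lemma flatWB : zmod_morphism flatW.
Proof.
move=> P Q; set n := maxn (size P) (size Q).
rewrite !(@flatWE n) ?leq_maxl ?leq_maxr //; last first.
  by rewrite (leq_trans (size_polyD _ _)) // size_polyN.
by rewrite -sumrB; apply: eq_bigr => i _; rewrite coefB hornerTB iter_dmulB.
Qed.

Lemma flatWZC (c : K) P : flatW (c%:P *: P) = c%:P *: flatW P.
Proof.
rewrite (@flatWE (size P)) ?size_scale_leq // scaler_sumr.
by apply: eq_bigr => i _; rewrite coefZ mul_polyC hornerTZ iter_dmulZC.
Qed.

Lemma flatW_mulX P : flatW (P * 'X) = dmul (flatW P).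
Proof.
rewrite (@flatWE (size P).+1); last first.
  by rewrite (leq_trans (size_polyMleq _ _)) // size_polyX addn2.
rewrite big_ord_recl coefMX (zmod_morph0 hornerTB) add0r (zmod_morph_sum (@dmulB K)).
by apply: eq_bigr => i _; rewrite coefMX.
Qed.

Lemma flatW_mulXn k P : flatW (P * 'X^k) = iter k (@dmul K) (flatW P).
Proof. by elim: k => [|k IH]; rewrite ?mulr1 // exprSr mulrA flatW_mulX IH. Qed.

Lemma flatW_polyC p : flatW p%:P = hornerT p.
Proof. by rewrite (flatWE (size_polyC_leq1 p)) big_ord1 coefC. Qed.

(* ['X *: P + P^`()] is the normal form of the product [P x]. *)
Lemma flatW_mulx P : flatW ('X *: P + P^`()) = Tmul (flatW P).
Proof.
rewrite (zmod_morphD flatWB) [flatW P^`()](@flatWE (size P)); last first.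
  by rewrite (leq_trans (size_poly _ _)) // leq_pred.
rewrite (@flatWE (size P)) ?size_scale_leq // (zmod_morph_sum TmulB).
(* Moving [T] across [d^k] leaves [k d^(k-1)]; these corrections add up to the image of the formal
   derivative of [P]. *)
under [in RHS]eq_bigr => k _ do rewrite Tmul_iter_dmul -hornerTX -coefZ.
rewrite big_split /=; congr (_ + _).
have Pn := leqnn (size P); case: {-1}(size P) Pn => [|n] Pn; first by rewrite !big_ord0.
rewrite big_ord_recr [RHS]big_ord_recl /= mulr0n add0r.
have /leq_sizeP/(_ n (leqnn n)) -> : (size P^`() <= n)%N.
  by rewrite (leq_trans (size_poly _ _)) // -subn1 leq_subLR.
rewrite (zmod_morph0 hornerTB) (zmod_morph0 (@iter_dmulB K n)) addr0; apply: eq_bigr => k _.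
by rewrite coef_deriv (zmod_morphMn hornerTB) (zmod_morphMn (@iter_dmulB K _)).
Qed.

(** Since [T = ell - x] and flat sends [x] to [T], the image of [P T] is [ell - T = x] times the
    image of [P]. *)
Lemma flatW_mulT P : flatW (mulT P) = 'X *: flatW P.
Proof.
have -> : mulT P = ell * P - ('X *: P + P^`()) by rewrite /mulT -mul_polyC; ring.
rewrite flatWB flatW_mulx TmulE wmul_ell /ell mulrBl flatWB.
rewrite ['X^r * P]mulrC flatW_mulXn mulr_suml (zmod_morph_sum flatWB).
under eq_bigr => k _ do rewrite -mulrA mul_polyC flatWZC ['X^_ * P]mulrC flatW_mulXn.
by rewrite opprB addrCA subrr addr0.
Qed.

Lemma flatW_airy_basis p k :
  flatW (p *: airy_basis k) = 'X^(k %/ r) *: iter (k %% r) (@dmul K) (hornerT p).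
Proof.
rewrite /airy_basis; elim: (k %/ r)%N => [|m IH] /=.
  by rewrite scale1r -mul_polyC flatW_mulXn flatW_polyC.
by rewrite -mulTZ flatW_mulT IH scalerA exprS.
Qed.

End Airy.

(** * Determinants and weights *)

Section Matrices.

(** Induction on the number of blocks, splitting off the first [r] rows and columns. *)
Lemma det_block_diagonal (K : comNzRingType) n r (E : nat -> nat -> nat -> K) :
  \det (\matrix_(i < n * r, j < n * r)
     (if (i %/ r == j %/ r)%N then E (i %/ r)%N (i %% r)%N (j %% r)%N else 0))
  = \prod_(k < n) \det (\matrix_(s < r, t < r) E k s t).
Proof.
elim: n E => [|n IH] E; first by rewrite big_ord0 det_mx00.
rewrite big_ord_recl -(IH (fun k => E k.+1)).
set M := (X in \det X = _); case: (posnP r) => [r0|r_gt0].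
  have z m : (m * r = 0)%N by rewrite r0 muln0.
  have d0 m (B : 'M[K]_m) : m = 0%N -> \det B = 1 by move=> m0; move: B; rewrite m0 => B; rewrite det_mx00.
  by rewrite !d0 ?mulr1.
have dv (i : 'I_(n * r)) : ((r + i) %/ r = (i %/ r).+1)%N.
  by rewrite divnDl // divnn r_gt0.
have ds (i : 'I_r) : (i %/ r = 0)%N by rewrite divn_small.
have ms (i : 'I_r) : (i %% r = i)%N by rewrite modn_small.
have -> : M = block_mx (\matrix_(s < r, t < r) E 0%N s t) 0 0
   (\matrix_(i < n * r, j < n * r)
     (if (i %/ r == j %/ r)%N then E (i %/ r).+1 (i %% r)%N (j %% r)%N else 0)).
  rewrite -[LHS](@submxK _ r (n * r) r (n * r)); congr block_mx; apply/matrixP=> i j;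
    by rewrite !mxE /= ?dv ?ds ?modnDl ?ms ?eqSS ?eqxx.
by rewrite [LHS](@det_ublock _ r (n * r)).
Qed.

Section Kronecker.
Variables (K : fieldType) (n r : nat).

Fact ord_mul_gt0 (k : 'I_(n * r)) : (0 < r)%N.
Proof. by case: r k => // -[]; rewrite muln0. Qed.

Fact ord_div_subproof (k : 'I_(n * r)) : (k %/ r < n)%N.
Proof. by rewrite ltn_divLR ?(ord_mul_gt0 k). Qed.

Fact ord_mod_subproof (k : 'I_(n * r)) : (k %% r < r)%N.
Proof. by rewrite ltn_pmod ?(ord_mul_gt0 k). Qed.

Definition ord_div k := Ordinal (ord_div_subproof k).
Definition ord_mod k := Ordinal (ord_mod_subproof k).

Lemma sum_ord_divmod (V : nmodType) (F : 'I_n -> 'I_r -> V) :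
  \sum_(k < n * r) F (ord_div k) (ord_mod k) = \sum_(i < n) \sum_(s < r) F i s.
Proof.
rewrite pair_big /=.
have lt (p : 'I_n * 'I_r) : (p.1 * r + p.2 < n * r)%N.
  have /leq_trans -> // : (p.1 * r + p.2 < p.1.+1 * r)%N by rewrite mulSnr ltn_add2l.
  by rewrite leq_mul2r ltn_ord orbT.
rewrite (reindex (fun k => (ord_div k, ord_mod k))) //=.
exists (fun p => Ordinal (lt p)) => [k _|[i s] _]; first by apply: val_inj; rewrite /= -divn_eq.
congr pair; apply: val_inj; rewrite /=.
  by rewrite divnMDl ?(leq_trans _ (ltn_ord s)) // divn_small ?addn0.
by rewrite modnMDl modn_small.
Qed.

Definition kron (A : 'M[K]_n) (B : 'M[K]_r) : 'M[K]_(n * r) :=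
  \matrix_(i, j) (A (ord_div i) (ord_div j) * B (ord_mod i) (ord_mod j)).

Lemma mulmx_kron A A' B B' : kron A B *m kron A' B' = kron (A *m A') (B *m B').
Proof.
apply/matrixP=> i j; rewrite !mxE.
under eq_bigr => k _ do rewrite !mxE.
rewrite (sum_ord_divmod (fun p q => A (ord_div i) p * B (ord_mod i) q *
   (A' p (ord_div j) * B' q (ord_mod j)))) mulr_suml.
apply: eq_bigr => p _; rewrite mulr_sumr; apply: eq_bigr => q _; ring.
Qed.

Lemma kron_unitmx A B : A \in unitmx -> B \in unitmx -> kron A B \in unitmx.
Proof.
move=> Au Bu; have : kron A B *m kron (invmx A) (invmx B) = 1%:M.
  rewrite mulmx_kron !mulmxV //; apply/matrixP=> i j; rewrite !mxE -natrM mulnb.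
  congr (_ %:R); congr nat_of_bool; apply/andP/eqP => [[/eqP[di] /eqP[mi]]|-> //].
  by apply: val_inj; rewrite /= (divn_eq i r) (divn_eq j r) di mi.
by case/mulmx1_unit.
Qed.

End Kronecker.

(** A permutation matrix is inverted by its transpose. *)
Lemma cyclic_unitmx (K : fieldType) r :
  (\matrix_(s < r, t < r) (t == s.+1 %% r :> nat)%N%:R : 'M[K]_r) \in unitmx.
Proof.
set M := (X in X \in _); have : M *m M^T = 1%:M.
  apply/matrixP=> i j; rewrite !mxE (bigD1 (ordS i)) //= big1 => [|t].
    rewrite !mxE /= eqxx mul1r addr0; congr (_ %:R); congr nat_of_bool.
    by apply/eqP/eqP => [|-> //] ij; apply: (@ordS_inj r); apply: val_inj.
  by move=> /negPf ti; rewrite !mxE; move: ti; rewrite -val_eqE /= => ->; rewrite mul0r.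
by case/mulmx1_unit.
Qed.

(** The weights are only bounds on the degrees, so that the coefficient at the total weight stays
    multiplicative when some factors fall short of their bound. *)
Lemma coef_prod_top (K : comNzRingType) I (s : seq I) (p : I -> {poly K}) (w : I -> nat) :
  (forall i, size (p i) <= (w i).+1)%N ->
  (size (\prod_(i <- s) p i)%R <= (\sum_(i <- s) w i).+1)%N /\
  (\prod_(i <- s) p i)`_(\sum_(i <- s) w i)%N = \prod_(i <- s) (p i)`_(w i).
Proof.
move=> sz; elim: s => [|i s [IHs IHc]].
  by rewrite !big_nil size_poly1 coef1.
rewrite !big_cons; set q := \prod_(j <- s) _ in IHs IHc *; set b := (\sum_(j <- s) _)%N in IHs IHc *.
split.
  rewrite (leq_trans (size_polyMleq _ _)) // -subn1 leq_subLR add1n -addnS -addSn.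
  exact: leq_add.
rewrite -IHc coefM (bigD1 (inord (w i))) //= inordK ?ltnS ?leq_addr // addKn.
rewrite big1 ?addr0 // => k; rewrite -val_eqE /= inordK ?ltnS ?leq_addr // => ki.
have [lt|gt|e] := ltngtP k (w i); last by rewrite e eqxx in ki.
  rewrite [q`__]nth_default ?mulr0 // (leq_trans IHs) //.
  by rewrite ltn_subRL ltn_add2r.
by rewrite nth_default ?mul0r // (leq_trans (sz i)).
Qed.

(** Each term of the Leibniz expansion takes one entry from every row, so degree bounds on the rows
    add up. *)
Lemma det_top (K : comNzRingType) n (B : 'M[{poly K}]_n) (w : 'I_n -> nat) :
  (forall i j, size (B i j) <= (w i).+1)%N ->
  (size (\det B)%R <= (\sum_i w i).+1)%N /\
  (\det B)`_(\sum_i w i)%N = \det (\matrix_(i, j) (B i j)`_(w i)).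
Proof.
move=> sz; have H (s : {perm 'I_n}) := coef_prod_top (index_enum 'I_n) (fun i => sz i (s i)).
split.
  apply/leq_sizeP=> j le; rewrite coef_sum big1 // => s _; apply: nth_default.
  by rewrite (leq_trans _ le) //; case: odd_perm; rewrite ?expr1 ?expr0 ?mulN1r ?size_polyN ?mul1r (H s).1.
rewrite coef_sum; apply: eq_bigr => s _; under [in RHS]eq_bigr => i _ do rewrite mxE.
rewrite -(H s).2; case: (odd_perm s); rewrite ?expr1 ?expr0 ?mulN1r ?coefN ?mul1r //.
Qed.

End Matrices.

(** * The polynomial matrix [Z] of the kernel columns and its weighted degrees *)

Section AiryMatrix.
Variables (K : fieldType) (r n : nat) (a lam gam : nat -> K).
Hypothesis r_gt1 : (1 < r)%N.

(* Companion matrix of [d^r - sum a_k d^k - (x + lam i)]. *)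
Definition airy_comp (i s t : nat) : {poly K} :=
  if (s.+1 < r)%N then (t == s.+1)%:R
  else if t == 0%N then 'X + (lam i)%:P
  else if (t < r.-1)%N then (a t)%:P else 0.

(* Coordinates of [d^s T^m (d + gam i)] on [1, d, ..., d^(r-1)], modulo the left
   ideal of [T - lam i], where [k = m r + s] and [l = i r + t]. *)
Definition airy_mx (k l : nat) : {poly K} :=
  (lam (l %/ r)%N ^+ (k %/ r)%N) *: airy_comp (l %/ r)%N (k %% r)%N (l %% r)%N
  + (gam (l %/ r)%N * lam (l %/ r)%N ^+ (k %/ r)%N
      + lam (l %/ r)%N ^+ (k %/ r).-1 *+ (k %/ r)%N)%:P *+ (l %% r == k %% r)%N.

(** For [s < r - 1] the only entry sits at [t = s + 1]; in the last row [x] has weight [r] at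
    [t = 0], while [a t] contributes only [t < r]. So the top weight [s + 1] occurs exactly along
    the cyclic shift. *)
Lemma airy_comp_weight i s t : (s < r)%N -> (t < r)%N ->
  exists2 q, (airy_comp i s t \Po 'X^r) * 'X^t = (t == s.+1 %% r)%N%:R *: 'X^(s.+1) + q
    & (size q <= s.+1)%N.
Proof.
move=> sr tr; rewrite /airy_comp; case: ifP => [s1r|/negbT].
  exists 0; rewrite ?size_poly0 // addr0 modn_small // rmorph_nat.
  by case: eqP => [->|_]; rewrite ?mul1r ?scale1r ?mul0r ?scale0r.
rewrite -leqNgt => rs; have -> : s.+1 = r by apply/eqP; rewrite eqn_leq rs sr.
rewrite modnn; case: eqP => [->|/eqP t0].
  exists (lam i)%:P; last by rewrite (leq_trans (size_polyC_leq1 _)) // ltnW.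
  by rewrite comp_polyD comp_polyX comp_polyC mulr1 scale1r.
case: ifP => _; rewrite scale0r; last first.
  by exists 0; rewrite ?size_poly0 // rmorph0 mul0r addr0.
exists ((a t)%:P * 'X^t); first by rewrite comp_polyC add0r.
by rewrite mul_polyC (leq_trans (size_scale_leq _ _)) // size_polyXn.
Qed.

(** The scalar correction lies on [t = s] and has weight [s], below the top weight [s + 1]; only the
    companion part survives. *)
Lemma airy_mx_weight k l :
  (size ((airy_mx k l \Po 'X^r) * 'X^(l %% r))%R <= (k %% r).+2)%N /\
  ((airy_mx k l \Po 'X^r) * 'X^(l %% r)%N)`_(k %% r).+1
   = lam (l %/ r)%N ^+ (k %/ r)%N * (l %% r == (k %% r).+1 %% r)%N%:R.
Proof.
have r0 := ltnW r_gt1.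
have [q eq sq] := airy_comp_weight (l %/ r) (ltn_pmod k r0) (ltn_pmod l r0).
rewrite /airy_mx; set c := lam _ ^+ _; set d := (X in X%:P).
have [q' -> sq'] : exists2 q' : {poly K}, ((c *: airy_comp (l %/ r)%N (k %% r)%N (l %% r)%N + d%:P *+ (l %% r == k %% r)%N)
   \Po 'X^r) * 'X^(l %% r)%N = (c * (l %% r == (k %% r).+1 %% r)%N%:R) *: 'X^((k %% r).+1) + q'
   & (size q' <= (k %% r).+1)%N.
  exists (c *: q + (d%:P *+ (l %% r == k %% r)%N) * 'X^(l %% r)%N).
    rewrite comp_polyD comp_polyZ mulrDl -scalerAl eq scalerDr scalerA addrA.
    by congr (_ + _ * _); case: eqP; rewrite ?comp_polyC ?comp_poly0.
  rewrite (leq_trans (size_polyD _ _)) // geq_max (leq_trans (size_scale_leq _ _)) //=.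
  case: eqP => [->|_]; rewrite ?mul0r ?size_poly0 //.
  by rewrite mul_polyC (leq_trans (size_scale_leq _ _)) // size_polyXn.
split; last by rewrite coefD coefZ coefXn eqxx mulr1 nth_default ?addr0.
rewrite (leq_trans (size_polyD _ _)) // geq_max (leq_trans (size_scale_leq _ _)) ?size_polyXn //=.
exact: leqW.
Qed.

Lemma sum_mod_weight : (\sum_(l < n * r) (l %% r).+1 = \sum_(l < n * r) l %% r + n * r)%N.
Proof.
under eq_bigr => l _ do rewrite -addn1.
by rewrite big_split /= sum1_card card_ord.
Qed.

(* Substituting ['X^r] for ['X] and multiplying column [l] by ['X^t] makes the weight
   of a row the degree of its entries. *)
Lemma det_airy_mx_weight (g : 'I_(n * r) -> nat) :
  let A := \matrix_(i, j) airy_mx (g i) j in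
  (size ((\det A \Po 'X^r) * 'X^(\sum_(l < n * r) l %% r))%R <= (\sum_i (g i %% r).+1).+1)%N /\
  ((\det A \Po 'X^r) * 'X^(\sum_(l < n * r) l %% r)%N)`_(\sum_i (g i %% r).+1)%N
   = \det (\matrix_(i < n * r, j < n * r)
      (lam (j %/ r)%N ^+ (g i %/ r)%N * (j %% r == (g i %% r).+1 %% r)%N%:R)).
Proof.
move=> A.
pose B := map_mx (comp_poly 'X^r) A *m diag_mx (\row_(l < n * r) 'X^(l %% r)%N).
have BE i j : B i j = (airy_mx (g i) j \Po 'X^r) * 'X^(j %% r).
  by rewrite /B mul_mx_diag !mxE.
have -> : (\det A \Po 'X^r) * 'X^(\sum_(l < n * r) l %% r)%N = \det B.
  rewrite det_mulmx det_map_mx det_diag; congr (_ * _).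
  by under [RHS]eq_bigr => l _ do rewrite mxE; rewrite expr_sum.
have sz i j : (size (B i j) <= (g i %% r).+2)%N by rewrite BE (airy_mx_weight _ _).1.
have [s c] := det_top sz; split => //; rewrite c; congr (\det _).
by apply/matrixP=> i j; rewrite !mxE -(airy_mx_weight _ _).2 -BE mxE.
Qed.

(** Row weights minus column weights bound [r] times the degree. The zero determinant is set apart
    because [(size 0).-1] also reads as degree 0. *)
Lemma size_det_airy_mx (g : 'I_(n * r) -> nat) (A := \matrix_(i, j) airy_mx (g i) j) :
  ((size (\det A)).-1 * r + \sum_(l < n * r) l %% r <= \sum_i (g i %% r).+1)%N
  \/ \det A = 0.
Proof.
case: (eqVneq (\det A) 0) => [->|A0]; [by right|left].
have [s _] := det_airy_mx_weight g; move: s; rewrite -/A size_mulXn; last first.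
  by rewrite comp_poly_eq0 ?size_polyXn // ltnS ltnW.
have := size_comp_poly (\det A) 'X^r; rewrite size_polyXn /= => <-.
by move=> s; rewrite addnC -ltnS -addnS prednK // size_poly_gt0 comp_poly_eq0 ?size_polyXn // ltnS ltnW.
Qed.

Hypothesis lam_inj : forall i j : nat, (i < n)%N -> (j < n)%N -> lam i = lam j -> i = j.

(** The matrix is the Kronecker product of a Vandermonde matrix with distinct nodes and the cyclic
    shift. *)
Lemma det_airy_top_neq0 :
  \det (\matrix_(i < n * r, j < n * r)
      (lam (j %/ r)%N ^+ (i %/ r)%N * (j %% r == (i %% r).+1 %% r)%N%:R)) != 0.
Proof.
have Vu : Vandermonde n (\row_(i < n) lam i) \in unitmx.
  rewrite unitmxE det_Vandermonde unitfE prodf_seq_neq0; apply/allP=> i _ /=.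
  rewrite prodf_seq_neq0; apply/allP=> j _; apply/implyP=> ij; rewrite !mxE subr_eq0.
  by apply/eqP=> /(lam_inj (ltn_ord j) (ltn_ord i)) ji; rewrite ji ltnn in ij.
have := kron_unitmx Vu (cyclic_unitmx K r); rewrite unitmxE unitfE.
by congr (_ != 0); congr (\det _); apply/matrixP=> i j; rewrite !mxE.
Qed.

(** The row weights exceed the column weights by [n r] in total, and the coefficient at that weight
    is the nonzero determinant above; dividing by [r] gives degree [n]. *)
Lemma size_det_airy_mx_id :
  size (\det (\matrix_(i < n * r, j < n * r) airy_mx i j)) = n.+1.
Proof.
have := det_airy_mx_weight (fun i => i); set A := \matrix_(_, _) _ => /= -[s c].
have c0 := det_airy_top_neq0; rewrite -c sum_mod_weight in c0.
have A0 : \det A != 0.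
  by apply: contraNneq c0 => ->; rewrite comp_poly0 mul0r coef0.
have AX0 : \det A \Po 'X^r != 0 by rewrite comp_poly_eq0 ?size_polyXn // ltnS ltnW.
rewrite sum_mod_weight size_mulXn // -addnS leq_add2l in s.
have := size_comp_poly (\det A) 'X^r; rewrite size_polyXn /= => e.
have {}c0 : (n * r < size (\det A \Po 'X^r))%N.
  by rewrite ltnNge; apply: contra c0 => le; rewrite nth_default // size_mulXn // leq_add2l.
have sz : size (\det A \Po 'X^r) = (n * r).+1 by apply/eqP; rewrite eqn_leq s.
rewrite sz /= in e; rewrite -[LHS]prednK ?size_poly_gt0 //; congr _.+1.
by apply/eqP; rewrite -(@eqn_pmul2r r) ?(ltnW r_gt1) // -e.
Qed.

End AiryMatrix.

(** * Wronskians of solutions *)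

Section Derivatives.
Variable K : numFieldType.
Implicit Types (g : K -> K) (x l c : K).

Lemma derive1n_shift k g l x : derive1n k (fun y => g (y + l)) x = derive1n k g (x + l).
Proof.
elim: k x => [//|k IH] x; rewrite /derive1n /=.
have -> : iter k (derive1 (V:=K)) (fun y => g (y + l)) = fun y => derive1n k g (y + l).
  by apply/funext.
rewrite /derive1; suff -> : (fun h => h^-1 *: (derive1n k g (h + x + l) - derive1n k g (x + l))) =
  (fun h => h^-1 *: (derive1n k g (h + (x + l)) - derive1n k g (x + l))) by [].
by apply/funext => h; rewrite addrA.
Qed.

Lemma is_derive_cvg g x d : is_derive x 1 g d ->
  ((fun h => h^-1 *: ((g \o shift x) (h *: 1) - g x)) @ 0^' --> d)%classic.
Proof. by move=> [dg <-]. Qed.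

Lemma cvg_is_derive g x d :
  ((fun h => h^-1 *: ((g \o shift x) (h *: 1) - g x)) @ 0^' --> d)%classic ->
  is_derive x 1 g d.
Proof. by move=> gd; apply: DeriveDef; [apply: cvgP gd | apply: cvg_lim gd]. Qed.

Definition smooth g := forall k x, derivable (derive1n k g) x 1.

Lemma smooth_is_derive g k x : smooth g -> is_derive x 1 (derive1n k g) (derive1n k.+1 g x).
Proof. by move=> sg; rewrite /derive1n /= derive1E; apply/derivableP/sg. Qed.

Lemma is_derive_derive1 g x d : is_derive x 1 g d -> derive1 g x = d.
Proof. by move=> [_ <-]; rewrite derive1E. Qed.

Lemma is_derive_sum_seq I (s : seq I) (P : pred I) (g : I -> K -> K) (d : I -> K) x :
  (forall i, is_derive x 1 (g i) (d i)) ->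
  is_derive x 1 (fun y => \sum_(i <- s | P i) g i y) (\sum_(i <- s | P i) d i).
Proof.
move=> gd; elim: s => [|i s IH].
  rewrite big_nil; have -> : (fun y => \sum_(i <- [::] | P i) g i y) = cst 0.
    by apply/funext => y; rewrite big_nil.
  exact: is_derive_cst.
rewrite big_cons; case: ifP => Pi.
  have -> : (fun y => \sum_(j <- i :: s | P j) g j y)
     = g i + (fun y => \sum_(j <- s | P j) g j y).
    by apply/funext => y; rewrite big_cons Pi.
  exact: is_deriveD.
have -> // : (fun y => \sum_(j <- i :: s | P j) g j y) = (fun y => \sum_(j <- s | P j) g j y).
by apply/funext => y; rewrite big_cons Pi.
Qed.

Lemma is_derive_prod_ord m (g : 'I_m -> K -> K) (d : 'I_m -> K) x :
  (forall i, is_derive x 1 (g i) (d i)) ->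
  is_derive x 1 (fun y => \prod_(i < m) g i y)
    (\sum_(k < m) \prod_(i < m) (if i == k then d i else g i x)).
Proof.
elim: m g d => [|m IH] g d gd.
  rewrite big_ord0; have -> : (fun y => \prod_(i < 0) g i y) = cst 1.
    by apply/funext => y; rewrite big_ord0.
  exact: is_derive_cst.
have -> : (fun y => \prod_(i < m.+1) g i y)
    = g ord0 * (fun y => \prod_(i < m) g (lift ord0 i) y).
  by apply/funext => y; rewrite big_ord_recl.
apply: is_derive_eq (is_deriveM (gd ord0) (IH _ _ (fun i => gd (lift ord0 i)))) _.
rewrite big_ord_recl addrC; congr (_ + _).
  rewrite [RHS]big_ord_recl eqxx mulrC; congr (_ * _).
rewrite [LHS]mulr_sumr; apply: eq_bigr => k _.
by rewrite [RHS]big_ord_recl; congr (_ * _).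
Qed.

Lemma is_derive_det m (M dM : 'I_m -> 'I_m -> K -> K) x :
  (forall i j, is_derive x 1 (M i j) (dM i j x)) ->
  is_derive x 1 (fun y => \det (\matrix_(i, j) M i j y))
    (\sum_k \det (\matrix_(i, j) if i == k then dM i j x else M i j x)).
Proof.
move=> Md.
have -> : (fun y => \det (\matrix_(i, j) M i j y))
  = fun y => \sum_(s : {perm 'I_m}) ((-1) ^+ s \*: (fun z => \prod_i M i (s i) z)) y.
  apply/funext => y; apply: eq_bigr => s _; congr (_ * _).
  by apply: eq_bigr => i _; rewrite mxE.
have -> : \sum_k \det (\matrix_(i, j) if i == k then dM i j x else M i j x)
  = \sum_(s : {perm 'I_m}) (-1) ^+ s *:
     \sum_(k < m) \prod_(i < m) (if i == k then dM i (s i) x else M i (s i) x).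
  rewrite exchange_big; apply: eq_bigr => s _; rewrite [RHS]mulr_sumr.
  apply: eq_bigr => k _; congr (_ * _).
  by apply: eq_bigr => i _; rewrite mxE.
apply: is_derive_sum_seq => s; apply: is_deriveZ.
exact: (is_derive_prod_ord (fun i => Md i (s i))).
Qed.

Lemma derive1n_kernel_fn g c k : smooth g ->
  derive1n k (fun y => derive1n 1 g y + c * g y)
  = fun y => derive1n k.+1 g y + c * derive1n k g y.
Proof.
move=> sg; elim: k => [//|k IH].
rewrite /derive1n iterS -/(derive1n _ _) IH; apply/funext => y; apply: is_derive_derive1.
apply: is_deriveD; first exact: smooth_is_derive.
exact: (is_deriveZ c (smooth_is_derive k y sg)).
Qed.

Section AiryEquation.
Variables (r : nat) (a : nat -> K).

Definition airy_solution g := forall x,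
  derive1n r g x = \sum_(1 <= k < r.-1) a k * derive1n k g x + x * g x.

(** The last term comes from the product rule on [x * g x]; at [k = 0] its truncated index [k.-1] is
    harmless, being multiplied by 0. *)
Lemma airy_solution_derive1n g k x : smooth g -> airy_solution g ->
  derive1n (r + k) g x = \sum_(1 <= j < r.-1) a j * derive1n (j + k) g x
    + x * derive1n k g x + derive1n k.-1 g x *+ k.
Proof.
move=> sg eqg; elim: k x => [|k IH] x.
  by rewrite mulr0n addr0 addn0 eqg; under [in RHS]eq_bigr => j _ do rewrite addn0.
rewrite addnS /derive1n iterS -!/(derive1n _ _).
have -> : derive1n (r + k) g = (fun y => \sum_(1 <= j < r.-1) (a j \*: derive1n (j + k) g) y)
    + id * derive1n k g + (k%:R \*: derive1n k.-1 g).
  by apply/funext => y; rewrite IH -[_ *+ k]mulr_natl.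
have d1 := is_derive_sum_seq (index_iota 1 r.-1) xpredT
  (fun j => is_deriveZ (a j) (smooth_is_derive (j + k) x sg)).
have d2 := is_deriveM (is_derive_id x 1) (smooth_is_derive k x sg).
have d3 := is_deriveZ (k%:R : K) (smooth_is_derive k.-1 x sg).
rewrite (is_derive_derive1 (is_deriveD (is_deriveD d1 d2) d3)).
rewrite -!addrA; congr (_ + (_ + _)).
  by apply: eq_bigr => j _; rewrite addnS.
case: k {IH d1 d2 d3} => [|k]; rewrite /GRing.scale /= ?mul0r ?addr0 ?mulr1 //.
by rewrite mulr_natl [RHS]mulrS.
Qed.

End AiryEquation.

(** Abel's identity: differentiating one row at a time, each row but the last becomes a copy of the
    next, and the last becomes dependent on the others because [L_0] has no [d^(r-1)] term. *)
Lemma is_derive_wronskian r (a : nat -> K) (f : nat -> K -> K) x : (1 < r)%N ->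
  (forall j, (j < r)%N -> smooth (f j)) ->
  (forall j, (j < r)%N -> airy_solution r a (f j)) ->
  is_derive x 1 (fun y => \det (\matrix_(i < r, j < r) derive1n i (f j) y)) 0.
Proof.
move=> r1 sf ef.
have Md (i j : 'I_r) : is_derive x 1 (derive1n i (f j)) (derive1n i.+1 (f j) x).
  by apply: smooth_is_derive; apply: sf.
apply: is_derive_eq (is_derive_det (dM := fun i j y => derive1n i.+1 (f j) y) Md) _; rewrite big1 // => k _.
have [kr|] := ltnP k.+1 r.
  apply: (@determinant_alternate _ _ _ k (Ordinal kr)).
    by rewrite -val_eqE /= ltn_eqF.
  move=> j; rewrite !mxE eqxx; case: eqP => [/(congr1 val)/= /eqP|_ //].
  by rewrite eqn_leq ltnn.
rewrite leq_eqVlt ltnNge ltn_ord orbF => /eqP rk.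
case: r a r1 f sf ef Md k rk => [|[|r']] // a' _ f sf ef Md k rk.
have {rk} -> : k = ord_max by apply: val_inj; case: rk.
set A := (X in \det X); apply/eqP/det0P.
(* Left null vector read off the equation: the differentiated last row minus [x] times row 0 minus
   [a' i] times row [i]. *)
pose v : 'rV[K]_r'.+2 := \row_i (if i == ord_max then 1 else if i == 0 then - x else - a' i).
exists v.
  by apply/eqP => /rowP/(_ ord_max); rewrite !mxE eqxx => /eqP; rewrite oner_eq0.
apply/rowP => j; rewrite !mxE; under eq_bigr => i _ do rewrite !mxE.
rewrite big_ord_recl big_ord_recr /=.
have -> : (lift ord0 (@ord_max r') == ord_max) = true by apply/eqP/val_inj.
rewrite mul1r -[X in _ + (_ + X)]/(derive1n r'.+2 (f j) x) ef // /= big_add1 big_mkord.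
rewrite (eq_bigr (fun i : 'I_r' => - (a' i.+1 * derive1n i.+1 (f j) x))) => [|i _].
  by rewrite sumrN; set S := \sum_(i < _) _; ring.
have -> : (lift ord0 (widen_ord (leqnSn r') i) == ord_max) = false.
  by apply/negbTE; rewrite -val_eqE /= /bump add1n eqSS ltn_eqF.
by rewrite mulNr.
Qed.

End Derivatives.

(** * Complex functions with zero derivative are constant *)

Section ComplexConstant.
Variable R : realType.
Local Notation C := (Cx R).

(** Along the line through [x] and [y] the real part becomes a function of a real variable with zero
    derivative, and the real theorem applies. *)
Lemma is_derive_0_Re_cst (g : C -> C) (x y : C) :
  (forall z : C, is_derive z 1 g 0) -> complex.Re (g x) = complex.Re (g y).
Proof.
move=> gd; have [->//|xy] := eqVneq x y.
pose w : C := y - x; pose om : R := complex.Re (`|w| : R[i]).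
have omE : (`|w| : R[i]) = (om%:C)%C by rewrite RRe_real // normr_real.
have om0 : 0 < om.
  have : 0 < (`|w| : R[i]) by rewrite normr_gt0 subr_eq0 eq_sym.
  by rewrite omE ltcR.
pose p (t : R) : C := x + (t%:C)%C * w.
pose u (t : R) : R := complex.Re (g (p t)).
have -> : complex.Re (g x) = u 0 by rewrite /u /p mul0r addr0.
have -> : complex.Re (g y) = u 1 by rewrite /u /p mul1r addrC subrK.
apply: is_derive_0_is_cst => t.
apply: cvg_is_derive.
have cg : ((fun h : C => h^-1 *: ((g \o shift (p t)) (h *: 1) - g (p t))) @ 0^' --> (0 : C))%classic.
  exact: is_derive_cvg.
apply/cvgr0Pnorm_lt => e e0.
(* A step [h] in [t] moves the argument by [h * w], so the quotient in [t] may be [|w|] times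
   larger; hence the tolerance [e / |w|]. *)
have e1 : 0 < ((e / om)%:C)%C :> C by rewrite ltcR divr_gt0.
have /cvgr0Pnorm_lt/(_ _ e1) := cg.
move=> /nbhs_ballP[d /= d0 hd].
have dE : d = ((complex.Re d)%:C)%C by rewrite RRe_real // gtr0_real.
have Rd0 : 0 < complex.Re d by move: d0; rewrite dE ltcR.
near=> h.
have h0 : h != 0 by near: h; apply: nbhs_dnbhs_neq.
have hlt : `|h| < complex.Re d / om by near: h; apply: dnbhs0_lt; rewrite divr_gt0.
pose hw : C := (h%:C)%C * w.
have nhC : `|(h%:C)%C : R[i]| = (`|h|%:C)%C.
  by rewrite normc_def /= expr0n addr0 sqrtr_sqr.
have nhw : (`|hw| : R[i]) = ((`|h| * om)%:C)%C by rewrite normrM nhC omE rmorphM.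
have hw0 : hw != 0 by rewrite mulf_neq0 ?fmorph_eq0 // subr_eq0 eq_sym.
have : `|hw^-1 *: ((g \o shift (p t)) (hw *: 1) - g (p t))| < ((e / om)%:C)%C :> R[i].
  apply: hd => //; rewrite -ball_normE /= sub0r normrN nhw dE ltcR.
  by rewrite -ltr_pdivlMr.
set G := _ - _; have GE : complex.Re G = (u \o shift t) (h *: 1) - u t.
  have -> : (u \o shift t) (h *: 1) = complex.Re ((g \o shift (p t)) (hw *: 1)).
    rewrite /u /p /= /GRing.scale /= !mulr1 rmorphD mulrDl; congr (complex.Re (g _)).
    by rewrite addrCA.
  have ReB (b c : R[i]) : complex.Re (b - c) = complex.Re b - complex.Re c.
    by case: b c => ? ? [? ?].
  exact: ReB.
rewrite normrM normfV nhw -GE => lt.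
have {}lt : (`|G| : R[i]) < ((`|h| * e)%:C)%C.
  rewrite mulrC ltr_pdivrMr ?ltcR ?mulr_gt0 ?normr_gt0 // -rmorphM /= in lt.
  by rewrite mulrCA divfK ?gt_eqF in lt.
have := le_lt_trans (normc_ge_Re G) lt; rewrite ltcR => {}lt.
by rewrite normrM normfV mulrC ltr_pdivrMr ?normr_gt0 // mulrC.
Unshelve. all: by end_near. Qed.

Lemma is_derive_0_complex_cst (g : C -> C) (x y : C) :
  (forall z : C, is_derive z 1 g 0) -> g x = g y.
Proof.
move=> gd; apply/eqP; rewrite eq_complex; apply/andP; split; apply/eqP.
  exact: is_derive_0_Re_cst.
(* The imaginary part is reached through ['i * g], whose real part is minus the imaginary part of
   [g]. *)
have gi (z : C) : is_derive z 1 (('i%C : C) \*: g) 0.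
  by have := is_deriveZ ('i%C : C) (gd z); rewrite scaler0.
have := is_derive_0_Re_cst x y gi.
by rewrite /= /GRing.scale /= mulrC [X in _ = complex.Re X]mulrC !ReiNIm => /oppr_inj.
Qed.

End ComplexConstant.

(** * The kernel operator *)

Section KernelJets.
Variables (K : fieldType) (r : nat) (a : nat -> K).

Lemma ev_Xn (F : nat -> K) x s : ev F x 'X^s = F s.
Proof.
rewrite -[X in ev _ _ X]mul1r ev_mulXn (@evE _ 1) ?size_poly1 // big_ord1 coef1 eqxx.
by rewrite hornerC mul1r addn0.
Qed.

(** The operator acts on [d + g] applied to a solution with jet [F]; the term with factor [k %/ r]
    comes from [T^m d = d T^m + m T^(m-1)]. *)
Lemma ev_airy_basis (lam g x : K) (F : nat -> K) k : airy_jet r a lam x F ->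
  ev (fun i => F i.+1 + g * F i) x (airy_basis r a k)
  = lam ^+ (k %/ r)%N * F (k %% r).+1
    + (g * lam ^+ (k %/ r)%N + lam ^+ (k %/ r).-1 *+ (k %/ r)%N) * F (k %% r)%N.
Proof.
move=> jF; rewrite /airy_basis; set s := (k %% r)%N.
have evG P : ev (fun i => F i.+1 + g * F i) x P = ev F x (P * 'X) + g * ev F x P.
  rewrite ev_mulX /ev mulr_sumr -big_split /=; apply: eq_bigr => i _; ring.
have evF m : ev F x (iter m (mulT r a) 'X^s) = lam ^+ m * F s.
  elim: m => [|m IH]; first by rewrite ev_Xn mul1r.
  by rewrite iterS (ev_mulT_jet _ jF) IH mulrA -exprS.
have evFX m : ev F x (iter m (mulT r a) 'X^s * 'X) = lam ^+ m * F s.+1 + lam ^+ m.-1 *+ m * F s.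
  elim: m => [|m IH]; first by rewrite -exprSr ev_Xn mul1r mulr0n mul0r addr0.
  rewrite iterS mulT_mulX (zmod_morphD (evB F x)) (ev_mulT_jet _ jF) IH evF.
  rewrite mulrDr !mulrA -exprS -addrA; congr (_ + _).
  case: m {IH} => [|m] /=; first by rewrite mulr0n mulr0 mul0r add0r.
  by rewrite mulrnAr -exprS -mulrDl -mulrSr.
by rewrite evG evFX evF; ring.
Qed.

(** All companion rows but the last shift the jet by one; the last is the differential equation,
    expressing [F r]. *)
Lemma sum_airy_comp (lam : nat -> K) i s x (F : nat -> K) : (1 < r)%N -> (s < r)%N ->
  airy_jet r a (lam i) x F ->
  \sum_(t < r) (airy_comp r a lam i s t).[x] * F t = F s.+1.
Proof.
move=> r1 sr jF; rewrite /airy_comp; case: (ltnP s.+1 r) => [s1r|rs].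
  rewrite (bigD1 (Ordinal s1r)) //= eqxx hornerC mul1r big1 ?addr0 // => t.
  by rewrite -val_eqE /= => /negPf ->; rewrite horner0 mul0r.
have -> : s.+1 = r by apply/eqP; rewrite eqn_leq rs sr.
have := jF 0%N; rewrite addn0 mulr0n addr0 => ->.
case: r a r1 sr rs jF => [|[|r']] // a' _ _ _ _.
rewrite big_ord_recl big_ord_recr /= hornerD hornerX hornerC big_add1 big_mkord addrC.
rewrite /bump /= add1n ltnn horner0 mul0r add0r.
rewrite addrC; congr (_ + _).
by apply: eq_bigr => t _; rewrite add1n ltnS ltn_ord hornerC addn0.
Qed.

End KernelJets.

(** * Orders of an operator and of its flat image from weight bounds *)

Section FlatOrder.
Variables (K : fieldType) (r n : nat) (a : nat -> K) (q : 'I_(n * r).+1 -> {poly K}).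
Hypothesis r_gt1 : (1 < r)%N.
Hypothesis q_weight : forall k, ((size (q k)).-1 * r + k %% r <= n * r)%N \/ q k = 0.
Hypothesis size_q_max : size (q ord_max) = n.+1.
Let P := \sum_k q k *: airy_basis r a k.

Let q_max_neq0 : q ord_max != 0.
Proof. by rewrite -size_poly_gt0 size_q_max. Qed.

Lemma coef_airy_sum : P`_(n * r) = q ord_max.
Proof.
rewrite coef_sum (bigD1 ord_max) //= coefZ big1 => [|k kN].
  have [/monicP + s] := airy_basis_monic a r_gt1 (n * r).
  by rewrite lead_coefE s /= => ->; rewrite mulr1 addr0.
have [_ s] := airy_basis_monic a r_gt1 k.
rewrite coefZ [(airy_basis r a k)`__]nth_default ?mulr0 // s.
by rewrite ltn_neqAle -ltnS ltn_ord andbT; apply: contra kN => /eqP e; apply/eqP/val_inj.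
Qed.

Lemma size_airy_sum : size P = (n * r).+1.
Proof.
apply/eqP; rewrite eqn_leq; apply/andP; split; last first.
  by rewrite ltnNge; apply: contra q_max_neq0 => /leq_sizeP/(_ _ (leqnn _)) <-; rewrite coef_airy_sum.
apply/leq_sizeP => j lej; rewrite coef_sum big1 // => k _.
have [_ s] := airy_basis_monic a r_gt1 k.
by rewrite coefZ [(airy_basis r a k)`__]nth_default ?mulr0 // s (leq_trans (ltn_ord k)).
Qed.

Let t (k : 'I_(n * r).+1) : {poly {poly K}} := iter (k %% r) (@dmul K) (hornerT r a (q k)).

Let flat_P : flatW r a P = \sum_(k < (n * r).+1) 'X^(k %/ r)%N *: t k.
Proof.
rewrite /P (zmod_morph_sum (flatWB r a)); apply: eq_bigr => k _.
by rewrite flatW_airy_basis.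
Qed.

Let size_t k : (size (t k) <= (n * r).+1)%N.
Proof.
have [w|q0] := q_weight k; last first.
  by rewrite /t q0 (zmod_morph0 (hornerTB r a)) (zmod_morph0 (@iter_dmulB K _)) size_poly0.
have s : (size (hornerT r a (q k)) <= (r * (size (q k)).-1).+1)%N.
  by apply: size_hornerT => //; apply: leqSpred.
by rewrite (leq_trans (size_iter_dmul _ s)) // addnS ltnS addnC mulnC.
Qed.

(** For nonzero [q k] and [s = k %% r > 0] the weight bound forces degree below [n], so the order is
    at most [s + r (n - 1) < n r]. For [s = 0] only the coefficient of degree [n] reaches order
    [n r]. *)
Let coef_t k : (t k)`_(n * r) = if (k %% r == 0)%N then ((q k)`_n)%:P else 0.
Proof.
have [w|q0] := q_weight k; last first.
  rewrite /t q0 (zmod_morph0 (hornerTB r a)) (zmod_morph0 (@iter_dmulB K _)) coef0 coef0.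
  by case: ifP.
have r_gt0 := ltnW r_gt1.
have [k0|k0] := eqVneq (k %% r)%N 0%N.
  rewrite k0 addn0 leq_pmul2r // in w.
  by rewrite /t k0 /= mulnC coef_hornerT // (leq_trans (leqSpred _)).
have dn : ((size (q k)).-1 < n)%N.
  by rewrite -(ltn_pmul2r r_gt0) (leq_trans _ w) // -addn1 leq_add2l lt0n.
have s : (size (hornerT r a (q k)) <= (r * (size (q k)).-1).+1)%N.
  by apply: size_hornerT => //; apply: leqSpred.
apply: nth_default; rewrite (leq_trans (size_iter_dmul _ s)) //.
rewrite (@leq_trans (r + r * (size (q k)).-1)%N) //; last by rewrite -mulnS mulnC leq_mul2r dn orbT.
by rewrite addnS -addSn leq_add2r ltn_pmod.
Qed.

Lemma size_flat_airy_sum : size (flatW r a P) = (n * r).+1.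
Proof.
have r_gt0 := ltnW r_gt1.
rewrite flat_P; apply/eqP; rewrite eqn_leq; apply/andP; split.
  apply/leq_sizeP => j lej; rewrite coef_sum big1 // => k _.
  by rewrite coefZ [(t k)`__]nth_default ?mulr0 // (leq_trans (size_t k)).
(* The coefficient of [x^n d^(n r)] is tested: [k %% r = 0] and [k %/ r = n] single out [k = n r],
   which contributes the leading coefficient of [q ord_max]. *)
rewrite ltnNge; apply/negP => /leq_sizeP/(_ _ (leqnn _)) /(congr1 (fun p : {poly K} => p`_n)).
rewrite coef0 !coef_sum (bigD1 ord_max) //= big1 => [|k kN].
  rewrite coefZ coef_t /= modnMl eqxx mulnK // mulrC mul_polyC coefZ coefXn eqxx mulr1 addr0.
  by move=> q0; have := q_max_neq0; rewrite -lead_coef_eq0 lead_coefE size_q_max q0 eqxx.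
rewrite coefZ coef_t; case: ifP => [/eqP k0|]; last by rewrite mulr0 coef0.
rewrite mulrC mul_polyC coefZ coefXn; case: eqP => [e|]; last by rewrite mulr0.
case/eqP: kN; apply: val_inj.
by rewrite /= [LHS](divn_eq k r) k0 addn0 -e.
Qed.

End FlatOrder.

(** * Agreement of [mulW], [hornerW] and [flat] with the normal forms *)

Section FlatDef.
Variable R : realType.
Local Notation C := (Cx R).

Lemma mulWE (P Q : weyl R) : mulW P Q = wmul P Q.
Proof.
apply: eq_bigr => i _; rewrite Leibniz_dmul exchange_big scaler_sumr; apply: eq_bigr => l _.
rewrite /map_poly poly_def mulr_suml -sumrMnl scaler_sumr; apply: eq_bigr => j _.
rewrite polyCMn polyCM -scalerMnr mulrnAl; congr (_ *+ _).
rewrite -mul_polyC -[_ *: 'X^j]mul_polyC -!mulrA -exprD; congr (_ * (_ * 'X^_)).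
by rewrite addnBA -1?ltnS // addnC.
Qed.

Lemma hornerW_L0W r a (p : {poly C}) : hornerW p (L0W r a) = hornerT r a p.
Proof.
apply: eq_bigr => i _; rewrite mul_polyC; congr (_ *: _).
by elim: (nat_of_ord i) => // k IH; rewrite iterS -IH /powW iterS mulWE.
Qed.

Lemma flatE r a (P : weyl R) : flat r a P = flatW r a P.
Proof. by apply: eq_bigr => k _; rewrite mulWE wmulXn hornerW_L0W. Qed.

End FlatDef.

(** * Minors of [Z] and factorization of the kernel columns *)

Section Bispectral.
Variables (K : fieldType) (r n : nat) (a lam gam : nat -> K).
Hypothesis r_gt1 : (1 < r)%N.
Local Notation N := (n * r)%N.

(* The deleted row index [k] stands for the basis element [d^s T^m], k = m r + s. *)
Definition airy_minor (k : 'I_N.+1) : {poly K} :=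
  \det (\matrix_(i < N, j < N) airy_mx r a lam gam (lift k i) j).

Lemma airy_minor_weight k :
  ((size (airy_minor k)).-1 * r + k %% r <= N)%N \/ airy_minor k = 0.
Proof.
rewrite /airy_minor.
have [w|] := size_det_airy_mx a lam gam r_gt1 (fun i : 'I_N => lift k i); [left|by right].
(* Rows [0, ..., N] have total weight equal to that of the columns plus [N + 1], row [N] itself
   having weight 1; deleting row [k] removes [k %% r + 1]. *)
have e : ((k %% r).+1 + \sum_(i < N) (lift k i %% r).+1 = \sum_(l < N) l %% r + N + 1)%N.
  have := @bigD1_ord _ addn 0%N N.+1 k xpredT (fun i => (i %% r).+1) isT.
  by rewrite big_ord_recr /= modnMl sum_mod_weight => <-; rewrite addn1.
move: e w; set L := (\sum_(i < N) (lift k i %% r).+1)%N; set S := (\sum_(l < N) _)%N.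
set d := (_.-1 * r)%N; lia.
Qed.

Lemma size_airy_minor_max :
  (forall i j : nat, (i < n)%N -> (j < n)%N -> lam i = lam j -> i = j) ->
  size (airy_minor ord_max) = n.+1.
Proof.
move=> lam_inj; rewrite -(size_det_airy_mx_id a gam r_gt1 lam_inj) /airy_minor.
by congr (size (polyseq (\det _))); apply/matrixP=> i j; rewrite !mxE lift_max.
Qed.

(** Modulo [T - lam i] every row reduces to the first [r] derivatives of the solutions, so the
    matrix is [airy_mx] at [x] times a block diagonal matrix with one Wronskian per [lam i]. *)
Lemma det_kernel_rows (x : K) (F : nat -> nat -> nat -> K) (g : 'I_N -> nat) :
  (forall i j, (i < n)%N -> (j < r)%N -> airy_jet r a (lam i) x (F i j)) ->
  \det (\matrix_(k < N, l < N)
     ev (fun i => F (l %/ r)%N (l %% r)%N i.+1 + gam (l %/ r)%N * F (l %/ r)%N (l %% r)%N i) x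
       (airy_basis r a (g k)))
  = (\det (\matrix_(i, j) airy_mx r a lam gam (g i) j)).[x]
    * \prod_(i < n) \det (\matrix_(s < r, j < r) F i j s).
Proof.
move=> jF; rewrite -(det_block_diagonal n r (fun i s j => F i j s)).
rewrite -horner_evalE -det_map_mx -det_mulmx; congr (\det _); apply/matrixP=> k l.
have r0 := ltnW r_gt1.
have jl := jF _ _ (ltn_ord (ord_div l)) (ltn_ord (ord_mod l)).
rewrite !mxE (ev_airy_basis _ _ jl).
under eq_bigr => p _ do rewrite !mxE.
rewrite (sum_ord_divmod (fun p t => horner_eval x (lam p ^+ (g k %/ r)%N *: airy_comp r a lam p (g k %% r)%N t
  + (gam p * lam p ^+ (g k %/ r)%N + lam p ^+ (g k %/ r)%N.-1 *+ (g k %/ r)%N)%:P *+ (t == g k %% r :> nat)%N)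
  * (if (p == l %/ r :> nat)%N then F p (l %% r)%N t else 0))).
rewrite (bigD1 (ord_div l)) //= [X in _ = _ + X]big1 ?addr0 => [|p]; last first.
  rewrite -val_eqE /= => /negPf pl; apply: big1 => t _.
  by rewrite pl mulr0.
rewrite eqxx -(sum_airy_comp r_gt1 (ltn_pmod _ r0) jl) mulr_sumr.
under [RHS]eq_bigr => t _ do rewrite horner_evalE hornerD hornerZ mulrDl -mulrA.
rewrite big_split /=; congr (_ + _).
rewrite (bigD1 (Ordinal (ltn_pmod (g k) r0))) //= eqxx hornerC big1 ?addr0 // => t.
by rewrite -val_eqE /= => /negPf ->; rewrite horner0 mul0r.
Qed.

End Bispectral.

Theorem mainTheorem6 (R : realType) (r : nat) (a : nat -> Cx R)
    (f : nat -> Cx R -> Cx R) (n : nat) (lam gam : nat -> Cx R) :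
  (1 < r)%N ->
  (* f_0, ..., f_{r-1} are entire functions ... *)
  (forall (j k : nat) (x : Cx R), (j < r)%N ->
      derivable (derive1n k (f j)) x 1) ->
  (* ... lying in ker L_0 ... *)
  (forall (j : nat) (x : Cx R), (j < r)%N ->
      derive1n r (f j) x
      = \sum_(1 <= k < r.-1) a k * derive1n k (f j) x + x * f j x) ->
  (* ... forming a basis normalized by |Wr(f_1,...,f_r)| = 1 *)
  (forall x : Cx R, `|\det (wronskian r f x)| = 1) ->
  (* C in D of dimension n: lam_0..lam_{n-1} pairwise distinct *)
  (0 < n)%N ->
  (forall i j : nat, (i < n)%N -> (j < n)%N -> lam i = lam j -> i = j) ->
  exists P : weyl R,
    (* (1) W is the differential operator P with polynomial coefficients *)
    (forall (u : Cx R -> Cx R) (x : Cx R),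
        Wdet r n f lam gam u x = actW P u x) /\
    (*     of order N = n r *)
    ordW P = (n * r)%N /\
    (* (2) the coefficient of d^N is a polynomial of degree exactly n *)
    size (lead_coef P) = n.+1 /\
    (* (3) K_C := P / (leading coeff. of that polynomial) has flat of order N *)
    ordW (flat r a ((lead_coef (lead_coef P))^-1%:P%:P * P)) = (n * r)%N.
Proof.
move=> r_gt1 f_derivable f_airy f_wr n_gt0 lam_inj.
have sf j : (j < r)%N -> smooth (f j) by move=> jr k x; apply: f_derivable.
have ef j : (j < r)%N -> airy_solution r a (f j) by move=> jr x; apply: f_airy.
pose D := \det (wronskian r f 0).
have D0 : D != 0 by rewrite -normr_eq0 f_wr oner_eq0.
(* The normalization fixes only the modulus; Abel's identity makes the Wronskian itself constant. *)
have Dcst x : \det (wronskian r f x) = D.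
  apply: (is_derive_0_complex_cst (g := fun y => \det (wronskian r f y))) => z.
  exact: (is_derive_wronskian z r_gt1 sf ef).
(* Cofactor sign for the last column, times the product of the [n] shifted Wronskians, each equal to
   [D]. *)
pose q (k : 'I_(n * r).+1) : {poly Cx R} :=
  ((-1) ^+ (k + n * r) * D ^+ n) *: airy_minor a lam gam k.
have c0 k : (-1) ^+ (k + n * r)%N * D ^+ n != 0 :> Cx R.
  by rewrite mulf_neq0 ?expf_neq0 // oppr_eq0 oner_eq0.
have qw k : ((size (q k)).-1 * r + k %% r <= n * r)%N \/ q k = 0.
  rewrite /q size_scale //; have [|->] := airy_minor_weight a lam gam r_gt1 k; [by left|right].
  by rewrite scaler0.
have qN : size (q ord_max) = n.+1 by rewrite size_scale // size_airy_minor_max.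
pose P : weyl R := \sum_k q k *: airy_basis r a k.
have sP : size P = (n * r).+1 by apply: size_airy_sum.
have PN : lead_coef P = q ord_max by rewrite lead_coefE sP /= coef_airy_sum.
exists P; split; last first.
  rewrite /ordW sP PN; split => //; split => //.
  rewrite flatE mul_polyC flatWZC size_scale; last first.
    by rewrite polyC_eq0 invr_eq0 lead_coef_eq0 -size_poly_gt0 qN.
  by rewrite size_flat_airy_sum.
move=> u x.
pose v k := if (k < n * r)%N then phi r f lam gam k else u.
(* [U] writes the operators [d^s T^m] in powers of [d]; being unitriangular, it changes the rows
   without changing the determinant. *)
pose U : 'M[Cx R]_((n * r).+1) := \matrix_(k, l) ((airy_basis r a k)`_l).[x].
have UW : U *m wronskian (n * r).+1 v x
    = \matrix_(k, l) ev (fun i => derive1n i (v l) x) x (airy_basis r a k).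
  apply/matrixP => k l; rewrite !mxE (evE (n := (n * r).+1)); last first.
    by have [_ ->] := airy_basis_monic a r_gt1 k; rewrite ltnS -ltnS ltn_ord.
  by apply: eq_bigr => i _; rewrite !mxE.
have detU : \det U = 1.
  rewrite det_trig; last first.
    apply/is_trig_mxP => k l kl; rewrite mxE nth_default ?horner0 //.
    by have [_ ->] := airy_basis_monic a r_gt1 k.
  apply: big1 => k _; rewrite mxE.
  by have [/monicP + s] := airy_basis_monic a r_gt1 k; rewrite lead_coefE s /= => ->; rewrite hornerC.
(* Expansion along the last column, that of [u]: each basis operator applied to [u] gets a minor of
   the kernel columns as coefficient. *)
rewrite /Wdet -/v -[LHS]mul1r -detU -det_mulmx UW (expand_det_col _ ord_max).
rewrite /actW -/(ev (fun k => derive1n k u x) x P) ev_sum.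
apply: eq_bigr => k _; rewrite evZ mxE mulrC /v ltnn; congr (_ * _).
(* Jets at [x] of the shifted solutions, on which [T] has eigenvalue [lam i]. *)
pose F i j s : Cx R := derive1n s (f j) (x + lam i).
have jF i j : (i < n)%N -> (j < r)%N -> airy_jet r a (lam i) x (F i j).
  by move=> _ jr s; apply: airy_solution_derive1n; [apply: sf|apply: ef].
rewrite /q hornerZ /cofactor -mulrA; congr (_ * _).
transitivity (\det (\matrix_(k' < n * r, l < n * r)
     ev (fun i => F (l %/ r)%N (l %% r)%N i.+1 + gam (l %/ r)%N * F (l %/ r)%N (l %% r)%N i) x
       (airy_basis r a (lift k k')))).
  congr (\det _); apply/matrixP => k' l; rewrite !mxE lift_max /v ltn_ord.
  congr (ev _ x _); apply/funext => i.
  have lr : (l %% r < r)%N by rewrite ltn_pmod // ltnW.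
  pose g y := derive1n 1 (f (l %% r)%N) y + gam (l %/ r)%N * f (l %% r)%N y.
  rewrite -[phi r f lam gam l]/(fun y => g (y + lam (l %/ r)%N)) derive1n_shift.
  by rewrite /g derive1n_kernel_fn //; apply: sf.
rewrite (det_kernel_rows gam r_gt1 _ jF) mulrC; congr (_ * _).
rewrite -[in RHS](card_ord n) -prodr_const; apply: eq_bigr => i _.
rewrite -(Dcst (x + lam i)); congr (\det _); by apply/matrixP => s j; rewrite !mxE.
Qed.
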